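(* Given $s>0$, there exists a constant $C=C(s)$, depending on $s$ only (and on the dimension $N$), such that for any closed $N$-simplex $K\subset\mathbb R^N$ with nonempty interior satisfying $h_K\le s\rho_K$ the following holds. If $x_0,\dots,x_N$ are the vertices of $K$ and $A_K$ is the $N\times N$ matrix whose columns are $(x_1-x_0),\dots,(x_N-x_0)$, then $A_K$ is invertible and $$\|A_K^{-1}\|\le C(s)h_K^{-1}.$$
   Context: $N\ge2$. For a simplex $K$, $h_K=\mathrm{diam}(K)$ and $\rho_K=\sup\{\mathrm{diam}(B):B\text{ is a ball contained in }K\}$. $\|\cdot\|$ is the operator norm of a matrix with respect to Euclidean norms. *)

(* Defs.v *)
From HB Require Import structures.
From mathcomp Require Import all_boot all_order all_algebra.
From mathcomp Require Import all_classical all_reals all_analysis.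

Set Implicit Arguments.
Unset Strict Implicit.
Unset Printing Implicit Defensive.

Import Order.TTheory GRing.Theory Num.Theory.
Import numFieldNormedType.Exports.

Local Open Scope classical_set_scope.
Local Open Scope ring_scope.

(* The library norm on matrices is the sup norm, whence this definition. The
   topology that it induces is nevertheless the Euclidean one, so the library's
   interior is the right one. *)
Definition enorm (R : realType) (n : nat) (v : 'cV[R]_n) : R :=
  Num.sqrt (\sum_(i < n) v i 0 ^+ 2).

(* For the real-valued sup here and below, sup E is the genuine supremum when E
   is nonempty and bounded above, and is 0 otherwise. *)
Definition diam (R : realType) (n : nat) (E : set 'cV[R]_n) : R :=
  sup [set d | exists2 u, E u & exists2 v, E v & d = enorm (u - v)].

Definition eball (R : realType) (n : nat) (c : 'cV[R]_n) (r : R) :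
    set 'cV[R]_n :=
  [set u | enorm (u - c) < r].

(* Open balls and closed balls give the same value when K is closed. *)
Definition inball_diam (R : realType) (n : nat) (K : set 'cV[R]_n) : R :=
  sup [set d | exists c r, [/\ 0 < r, eball c r `<=` K & d = diam (eball c r)]].

Definition opnorm (R : realType) (m n : nat) (A : 'M[R]_(m, n)) : R :=
  sup [set enorm (A *m v) | v in [set v : 'cV[R]_n | enorm v <= 1]].

(* The closed simplex spanned by the points x i, which may be affinely
   dependent. *)
Definition simplex (R : realType) (k n : nat) (x : 'I_k.+1 -> 'cV[R]_n) :
    set 'cV[R]_n :=
  [set u | exists t : 'I_k.+1 -> R,
     [/\ forall i, 0 <= t i, \sum_i t i = 1 & u = \sum_i t i *: x i]].

Definition edge_mx (R : realType) (k n : nat) (x : 'I_k.+1 -> 'cV[R]_n) :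
    'M[R]_(n, k) :=
  \matrix_(i < n, j < k) (x (lift ord0 j) - x ord0) i 0.

(* Main.v *)
Require Import Defs.
From HB Require Import structures.
From mathcomp Require Import all_boot all_order all_algebra.
From mathcomp Require Import all_classical all_reals all_analysis.
From mathcomp Require Import ring lra.

Import Order.TTheory GRing.Theory Num.Theory.
Import numFieldNormedType.Exports.

Local Open Scope classical_set_scope.
Local Open Scope ring_scope.

Set Implicit Arguments.
Unset Strict Implicit.
Unset Printing Implicit Defensive.

(** Barycentric coordinates relative to [x 0] map [K] into the cube [[0, 1]^N].
If [K] contains a ball of radius [r], then for [q < r] and [|v| <= 1] the
vector [q *: v] is a difference of two points of [K], hence
[q *: A_K^-1 v] is a difference of two points of the cube and
[|A_K^-1 v| <= sqrt N / q]. Since [h_K <= s * rho_K], some inscribed ball has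
radius larger than [q = h_K / (4 s)]. *)

Section EuclideanNorm.
Variables (R : realType) (n : nat).
Implicit Types u v c : 'cV[R]_n.

Lemma enorm_ge0 v : 0 <= enorm v.
Proof. exact: sqrtr_ge0. Qed.

Lemma sqr_enorm v : enorm v ^+ 2 = \sum_(i < n) v i 0 ^+ 2.
Proof. by rewrite sqr_sqrtr // sumr_ge0 // => i _; exact: sqr_ge0. Qed.

Lemma enormZ (a : R) v : enorm (a *: v) = `|a| * enorm v.
Proof.
rewrite /enorm -sqrtr_sqr -sqrtrM ?sqr_ge0 // mulr_sumr; congr Num.sqrt.
by apply: eq_bigr => i _; rewrite mxE exprMn.
Qed.

Lemma enorm0 : enorm (0 : 'cV[R]_n) = 0.
Proof. by rewrite -(scale0r 0) enormZ normr0 mul0r. Qed.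

Lemma ler_coord_enorm v i : `|v i 0| <= enorm v.
Proof.
rewrite -sqrtr_sqr ler_wsqrtr // (bigD1 i) //= lerDl.
by rewrite sumr_ge0 // => j _; exact: sqr_ge0.
Qed.

Lemma enorm_eq0 v : enorm v = 0 -> v = 0.
Proof.
move=> v0; apply/colP => i; rewrite mxE; apply/eqP.
by rewrite -normr_le0 -v0 ler_coord_enorm.
Qed.

(** In each coordinate this is the parallelogram law with the nonnegative term [(u + v)^2] dropped.
    When both norms are at most [r] it yields [|u - v| <= 2 r], as the triangle inequality would. *)
Lemma sqr_enormB_le u v :
  enorm (u - v) ^+ 2 <= 2 * (enorm u ^+ 2 + enorm v ^+ 2).
Proof.
rewrite !sqr_enorm -big_split mulr_sumr ler_sum // => i _; rewrite !mxE /=.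
have := sqr_ge0 (u i 0 + v i 0); nra.
Qed.

Lemma diam_eball_le c (r : R) : 0 < r -> diam (eball c r) <= 2 * r.
Proof.
move=> r0; have ec : eball c r c by rewrite /eball /= subrr enorm0.
apply: ge_sup; first by exists (enorm (c - c)); exists c => //; exists c.
move=> _ [u uc [v vc ->]].
rewrite -(ler_pXn2r (ltn0Sn 1)) ?nnegrE ?enorm_ge0 ?mulr_ge0 ?(ltW r0) //.
have -> : u - v = (u - c) - (v - c) by rewrite opprB addrA subrK.
apply: (le_trans (sqr_enormB_le _ _)).
rewrite /eball /= in uc vc.
have := enorm_ge0 (u - c); have := enorm_ge0 (v - c); nra.
Qed.

(** The library balls are sup-norm balls. Each coordinate is bounded by the Euclidean norm, so the
    Euclidean ball of the same radius lies inside. *)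
Lemma eball_sub_interior (K : set 'cV[R]_n) :
  interior K !=set0 -> exists c r, 0 < r /\ eball c r `<=` K.
Proof.
move=> [c /nbhs_ballP [e /= e0 ceK]]; exists c, e; split => // u cu.
apply: ceK; split => // i j; rewrite ord1 /ball /= distrC.
by have := ler_coord_enorm (u - c) i; rewrite !mxE => /le_lt_trans; apply.
Qed.

End EuclideanNorm.

Section Simplex.
Variables (R : realType) (k n : nat) (x : 'I_k.+1 -> 'cV[R]_n).

Lemma simplex_vertex i : simplex x (x i).
Proof.
exists (fun j => (j == i)%:R); split => [j||]; first exact: ler0n.
  by rewrite (bigD1 i) //= eqxx big1 ?addr0 // => j /negPf ->.
rewrite (bigD1 i) //= eqxx scale1r big1 ?addr0 // => j /negPf ->.
by rewrite scale0r.
Qed.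

Lemma barycentric_le1 (t : 'I_k.+1 -> R) i :
  (forall j, 0 <= t j) -> \sum_j t j = 1 -> t i <= 1.
Proof.
by move=> t0 <-; rewrite (bigD1 i) //= lerDl sumr_ge0.
Qed.

Lemma simplex_edge_mx u : simplex x u ->
  exists2 w : 'cV[R]_k, forall j, 0 <= w j 0 <= 1 &
    u = x ord0 + edge_mx x *m w.
Proof.
move=> [t [t0 t1 ->]]; exists (\col_j t (lift ord0 j)) => [j|].
  by rewrite mxE t0 barycentric_le1.
apply/colP => i; rewrite !mxE summxE.
(* Spreading [x ord0] over the weights, whose sum is 1, lets both sides be compared vertex by
   vertex. *)
have -> : x ord0 i 0 = \sum_j t j * x ord0 i 0 by rewrite -mulr_suml t1 mul1r.
rewrite !big_ord_recl !mxE -addrA; congr (_ + _); rewrite -big_split /=.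
by apply: eq_bigr => j _; rewrite !mxE /=; ring.
Qed.

(** This makes the supremum in [diam (simplex x)] genuine. The weights are at most 1, so coordinate
    [i] is at most [M i] in absolute value. *)
Lemma simplex_enorm_bounded :
  exists M : R, forall u, simplex x u -> enorm u <= M.
Proof.
pose M i := \sum_j `|x j i 0|.
exists (Num.sqrt (\sum_i M i ^+ 2)) => u [t [t0 t1 ->]].
apply: ler_wsqrtr; apply: ler_sum => i _.
rewrite -[leLHS]real_normK ?num_real // lerXn2r ?nnegrE ?sumr_ge0 //.
rewrite summxE (le_trans (ler_norm_sum _ _ _)) // ler_sum // => j _.
by rewrite mxE normrM ger0_norm // ler_piMl // barycentric_le1.
Qed.

Lemma ler_dist_diam_simplex u v :
  simplex x u -> simplex x v -> enorm (u - v) <= diam (simplex x).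
Proof.
move=> xu xv; have [M xM] := simplex_enorm_bounded.
apply: ub_le_sup; last by exists u => //; exists v.
exists (2 * M) => _ [a xa [b xb ->]].
have M0 := le_trans (enorm_ge0 _) (xM _ xa).
rewrite -(ler_pXn2r (ltn0Sn 1)) ?nnegrE ?enorm_ge0 ?mulr_ge0 //.
apply: (le_trans (sqr_enormB_le _ _)).
have := xM _ xa; have := xM _ xb.
have := enorm_ge0 a; have := enorm_ge0 b; nra.
Qed.

(** The two points are [c] and [c + q *: v], and [w] is the difference of their coordinates in the
    cube. Phrased with preimages rather than an inverse, the result also serves to prove
    invertibility. *)
Lemma eball_sub_simplex_preimage c r v q : eball c r `<=` simplex x ->
  0 <= q < r -> enorm v <= 1 ->
  exists2 w : 'cV[R]_k, forall j, `|w j 0| <= 1 & edge_mx x *m w = q *: v.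
Proof.
move=> cx /andP[q0 qr] v1.
have r0 := le_lt_trans q0 qr.
have /cx/simplex_edge_mx[a a1 ca] : eball c r c.
  by rewrite /eball /= subrr enorm0.
have /cx/simplex_edge_mx[b b1 cb] : eball c r (c + q *: v).
  rewrite /eball /= addrC addKr enormZ ger0_norm //.
  by rewrite (le_lt_trans _ qr) // ler_piMr.
exists (b - a) => [j|].
  rewrite !mxE ler_norml; have /andP[? ?] := a1 j; have /andP[? ?] := b1 j.
  by apply/andP; split; lra.
rewrite mulmxBr; have := cb; rewrite {1}ca -addrA => /addrI <-.
by rewrite addrAC subrr add0r.
Qed.

End Simplex.

Section FullDimensionalSimplex.
Variables (R : realType) (n : nat) (x : 'I_n.+1 -> 'cV[R]_n).
Variables (c : 'cV[R]_n) (r : R).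
Hypothesis cx : eball c r `<=` simplex x.

Lemma edge_mx_unit : 0 < r -> edge_mx x \in unitmx.
Proof.
move=> r0; have q0 : 0 < r / 2 by lra.
have surj (v : 'cV[R]_n) : exists w, edge_mx x *m w == v.
  have [->|v0] := eqVneq v 0; first by exists 0; rewrite mulmx0.
  have ev : enorm v != 0 by apply: contra_neq v0 => /enorm_eq0.
  have [||w _ wv] := eball_sub_simplex_preimage
    (v := (enorm v)^-1 *: v) (q := r / 2) cx.
  - by apply/andP; split; lra.
  - by rewrite enormZ normfV ger0_norm ?enorm_ge0 // mulVf.
  exists ((enorm v * (r / 2)^-1) *: w).
  by rewrite -scalemxAr wv !scalerA mulfVK ?gt_eqF // mulfV // scale1r.
(* The columns of [W] are chosen preimages of the basis vectors, so [W] is a right inverse; for a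
   square matrix this suffices. *)
pose W := \matrix_(i, j) xchoose (surj (col j 1%:M)) i 0.
suff /mulmx1_unit[] : edge_mx x *m W = 1%:M by [].
apply/matrixP => i j; have /eqP/colP/(_ i) := xchooseP (surj (col j 1%:M)).
by rewrite !mxE => <-; apply: eq_bigr => l _; rewrite [W _ _]mxE.
Qed.

Lemma enorm_inv_edge_mx_le (v : 'cV[R]_n) q : 0 < q < r -> enorm v <= 1 ->
  enorm (invmx (edge_mx x) *m v) <= Num.sqrt n%:R / q.
Proof.
move=> /andP[q0 qr] v1; have r0 := lt_trans q0 qr.
have [|w w1 wv] := eball_sub_simplex_preimage (q := q) cx _ v1.
  by rewrite ltW.
have -> : invmx (edge_mx x) *m v = q^-1 *: w.
  rewrite -[w](mulKmx (edge_mx_unit r0)) wv -scalemxAr scalerA.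
  by rewrite mulVf ?gt_eqF // scale1r.
rewrite enormZ ger0_norm ?invr_ge0 ?(ltW q0) // [leRHS]mulrC.
rewrite ler_pM2l ?invr_gt0 //.
apply: ler_wsqrtr; rewrite -[n in leRHS]card_ord -sumr_const ler_sum // => i _.
by rewrite -real_normK ?num_real // exprn_ile1.
Qed.

Lemma opnorm_inv_edge_mx_le q : 0 < q < r ->
  opnorm (invmx (edge_mx x)) <= Num.sqrt n%:R / q.
Proof.
move=> qr; apply: ge_sup; last first.
  by move=> _ [v /= v1 <-]; exact: enorm_inv_edge_mx_le.
exists (enorm (invmx (edge_mx x) *m 0)), 0 => //=.
by rewrite enorm0 ler01.
Qed.

End FullDimensionalSimplex.

Lemma diam_simplex_gt0 (R : realType) (n : nat) (x : 'I_n.+1 -> 'cV[R]_n) :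
  (0 < n)%N -> edge_mx x \in unitmx -> 0 < diam (simplex x).
Proof.
case: n x => // n x _ xU.
have := ler_dist_diam_simplex (simplex_vertex x (lift ord0 ord0))
  (simplex_vertex x ord0).
apply: lt_le_trans; rewrite lt_def enorm_ge0 andbT.
apply/eqP => /enorm_eq0 x0.
(* If the first two vertices coincided, the first column would vanish and the matrix would kill a
   basis vector. *)
have : edge_mx x *m delta_mx ord0 (ord0 : 'I_1) = 0.
  by rewrite -colE; apply/colP => i; move/colP/(_ i): x0; rewrite !mxE.
move/(congr1 (mulmx (invmx (edge_mx x)))).
rewrite mulKmx // mulmx0 => /matrixP/(_ ord0 ord0)/eqP.
by rewrite !mxE !eqxx oner_eq0.
Qed.

Lemma inball_diam_gt (R : realType) (n : nat) (K : set 'cV[R]_n) (d : R) :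
  0 <= d -> d < inball_diam K ->
  exists c r, eball c r `<=` K /\ d < 2 * r.
Proof.
move=> d0 dK.
have [|y [c [r [r0 cK ->]]] dr] := sup_gt _ dK.
  (* With no inscribed ball the supremum takes its default value 0, contradicting
     [0 <= d < inball_diam K]. *)
  apply/set0P/eqP => E; move: dK; rewrite /inball_diam E sup0; lra.
by exists c, r; split => //; exact: lt_le_trans dr (diam_eball_le _ r0).
Qed.

Theorem lemma2p13 (R : realType) (N : nat) (hN : (2 <= N)%N)
    (s : R) (hs : 0 < s) :
  exists C : R,
    forall (K : set 'cV[R]_N) (x : 'I_N.+1 -> 'cV[R]_N),
      K = simplex x ->
      interior K !=set0 ->
      diam K <= s * inball_diam K ->
      edge_mx x \in unitmx /\
      opnorm (invmx (edge_mx x)) <= C * (diam K)^-1.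
Proof.
(* This is [sqrt N / q] at [q = h / (4 s)], with the factor [1 / h] taken out. *)
exists (4 * s * Num.sqrt N%:R) => K x ->.
move=> /eball_sub_interior[c0 [r0 [r0_gt0 c0x]]] hsrho.
have xU := edge_mx_unit c0x r0_gt0; split => //.
set h := diam _ in hsrho *.
have h0 : 0 < h by apply: diam_simplex_gt0 => //; exact: ltnW.
have hs0 : 0 < h / (2 * s) by rewrite divr_gt0 ?mulr_gt0.
(* The supremum need not be attained, so [h / s <= rho] is weakened to the strict [h / (2 s) < rho];
   passing from diameter to radius costs the other factor 2. *)
have [||c [r [cx hr]]] := @inball_diam_gt _ _ (simplex x) (h / (2 * s)).
- exact: ltW.
- by rewrite ltr_pdivrMr ?mulr_gt0 //; lra.
have q : 0 < h / (4 * s) < r.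
  rewrite divr_gt0 ?mulr_gt0 //=; move: hr.
  by rewrite !ltr_pdivrMr ?mulr_gt0 //; lra.
apply: (le_trans (opnorm_inv_edge_mx_le cx q)).
by rewrite invf_div mulrCA mulrA.
Qed.
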